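(* Let $(X,\mathcal{A})$ be a measurable space, let $\mu\colon\mathcal{A}\to[0,\infty]$ be a nonadditive measure, and let $0<p<\infty$. Assume that $\mu$ is relaxed subadditive, monotone autocontinuous from below, and has property (C). Then $\mathcal{L}^{p,\infty}(\mu)$ is complete with respect to the quasi-seminorm $\|\cdot\|_{p,\infty}$ and $L^{p,\infty}(\mu)$ is complete with respect to the quasi-norm $\|\cdot\|_{p,\infty}$.
   Context: $X$ is a nonempty set and $\mathcal{A}$ is a $\sigma$-field of subsets of $X$. A nonadditive measure is a set function $\mu\colon\mathcal{A}\to[0,\infty]$ with $\mu(\emptyset)=0$ and $\mu(A)\le\mu(B)$ whenever $A,B\in\mathcal{A}$, $A\subset B$. $\mathcal{F}_0(X)$ is the real linear space of all $\mathcal{A}$-measurable functions $X\to\mathbb{R}$. Relaxed subadditive: there is a constant $K\ge 1$ such that $\mu(A\cup B)\le K\{\mu(A)+\mu(B)\}$ for every disjoint $A,B\in\mathcal{A}$. Monotone autocontinuous from below: $\mu(A\setminus B_n)\to\mu(A)$ whenever $A,B_n\in\mathcal{A}$, $\{B_n\}_{n\in\mathbb{N}}$ is nonincreasing, and $\mu(B_n)\to 0$. (This implies null-additivity: $\mu(A\cup B)=\mu(A)$ whenever $\mu(B)=0$.) Property (C): for any sequence $\{E_n\}_{n\in\mathbb{N}}\subset\mathcal{A}$, if $\sup_{l\in\mathbb{N}}\mu\left(\bigcup_{n=k}^{k+l}E_n\right)\to 0$ as $k\to\infty$, then $\mu\left(\bigcup_{n=k}^\infty E_n\right)\to 0$ as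 $k\to\infty$. Shilkret integral: $\mathrm{Sh}(\nu,g):=\sup_{t\in[0,\infty)}t\,\nu(\{g>t\})\in[0,\infty]$ for a nonadditive measure $\nu$ and measurable $g\colon X\to[0,\infty)$ (with $0\cdot\infty=0$). With $\mu^{1/p}(A):=\mu(A)^{1/p}$, define $\|f\|_{p,\infty}:=\mathrm{Sh}(\mu^{1/p},|f|)\in[0,\infty]$ for $f\in\mathcal{F}_0(X)$, and $\mathcal{L}^{p,\infty}(\mu):=\{f\in\mathcal{F}_0(X):\|f\|_{p,\infty}<\infty\}$. $f\sim g$ iff $\mu(\{|f-g|>c\})=0$ for every $c>0$; this is an equivalence relation on $\mathcal{F}_0(X)$ here; $[f]$ is the class of $f$, with $[f]+[g]:=[f+g]$, $c[f]:=[cf]$. $L^{p,\infty}(\mu):=\{[f]: f\in\mathcal{L}^{p,\infty}(\mu)\}$ and $\|[f]\|_{p,\infty}:=\|f\|_{p,\infty}$ (well-defined since $\mu$ is null-additive). On a real linear space $V$, a quasi-seminorm is a function $\|\cdot\|\colon V\to[0,\infty)$ with $\|cx\|=|c|\|x\|$ for all $x\in V$, $c\in\mathbb{R}$, and $\|x+y\|\le K'\{\|x\|+\|y\|\}$ for all $x,y\in V$ and some constant $K'\ge1$; a quasi-norm is a quasi-seminorm such that $\|x\|=0$ implies $x=0$. Convergence $x_n\to x$ means $\|x_n-x\|\to 0$; $\{x_n\}$ is Cauchy if for any $\varepsilon>0$ there is $n_0$ with $\|x_m-x_n\|<\varepsilon$ for $m,n\ge n_0$; complete means every Cauchy sequence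 in the space converges to an element of the space. *)

(* Defs.v *)
From HB Require Import structures.
From mathcomp Require Import all_boot all_order all_algebra generic_quotient.
From mathcomp Require Import all_classical all_reals all_analysis.
From mathcomp Require Import measurable_realfun ring lra.

Set Implicit Arguments.
Unset Strict Implicit.
Unset Printing Implicit Defensive.

Import Order.TTheory GRing.Theory Num.Theory.
Import numFieldNormedType.Exports.

Local Open Scope classical_set_scope.
Local Open Scope ring_scope.
Local Open Scope quotient_scope.

Section quasi_seminorm.
Context {R : realType} {V : lmodType R}.
Implicit Types (N : V -> R) (u : nat -> V).

Definition quasi_seminorm N : Prop :=
  [/\ forall x, 0 <= N x,
      forall (c : R) x, N (c *: x) = `|c| * N x &
      exists2 K : R, 1 <= K & forall x y, N (x + y) <= K * (N x + N y)].

Definition quasi_norm N : Prop :=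
  quasi_seminorm N /\ forall x, N x = 0 -> x = 0.

Definition converges_in N u (x : V) : Prop :=
  (fun n => N (u n - x)) @ \oo --> (0 : R).

Definition cauchy_in N u : Prop :=
  forall e : R, 0 < e -> exists n0 : nat, forall m n : nat,
    (n0 <= m)%N -> (n0 <= n)%N -> N (u m - u n) < e.

Definition complete_in N : Prop :=
  forall u, cauchy_in N u -> exists x, converges_in N u x.

End quasi_seminorm.

(* Only the values on measurable sets are constrained (and used): this
   encodes a function on the sigma-field with values in [0, +oo]. *)
Record nonadditive_measure d (X : measurableType d) (R : realType) :=
  NonadditiveMeasure {
    na_mu :> set X -> \bar R ;
    na_mu0 : na_mu set0 = 0%E ;
    na_mu_ge0 : forall A, measurable A -> (0 <= na_mu A)%E ;
    na_mu_le : forall A B, measurable A -> measurable B -> A `<=` B ->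
      (na_mu A <= na_mu B)%E }.

Section nonadditive.
Context d {X : measurableType d} {R : realType}.
Implicit Type mu : nonadditive_measure X R.

Definition relaxed_subadditive mu : Prop :=
  exists2 K : R, 1 <= K & forall A B, measurable A -> measurable B ->
    A `&` B = set0 -> (mu (A `|` B) <= K%:E * (mu A + mu B))%E.

Definition monotone_autocontinuous_below mu : Prop :=
  forall (A : set X) (B : nat -> set X),
    measurable A -> (forall n, measurable (B n)) -> nonincreasing_seq B ->
    mu (B n) @[n --> \oo] --> 0%E ->
    mu (A `\` B n) @[n --> \oo] --> mu A.

Definition property_C mu : Prop :=
  forall E : nat -> set X, (forall n, measurable (E n)) ->
    ereal_sup [set mu (\bigcup_(n in [set n | (k <= n <= k + l)%N]) E n)
              | l in [set: nat]] @[k --> \oo] --> 0%E ->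
    mu (\bigcup_(n in [set n | (k <= n)%N]) E n) @[k --> \oo] --> 0%E.

Definition null_additive mu : Prop :=
  forall A B, measurable A -> measurable B -> mu B = 0%E ->
    mu (A `|` B) = mu A.

Definition Shilkret (nu : set X -> \bar R) (g : X -> R) : \bar R :=
  ereal_sup [set (t%:E * nu [set x | (t < g x)%R])%E | t in [set t : R | 0 <= t]].

(* [poweR] satisfies [+oo `^ p^-1 = +oo] for [0 < p], and [0 * +oo = 0]. *)
Definition weakLnorm mu (p : R) (f : X -> R) : \bar R :=
  Shilkret (fun A => (mu A `^ p^-1)%E) (fun x => `|f x|).

Definition mu_equiv mu (f g : {mfun X >-> R}) : bool :=
  `[< forall c : R, 0 < c -> mu [set x | c < `|f x - g x|] = 0%E >].

End nonadditive.

Section elementary.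
Context d {X : measurableType d} {R : realType}.
Variable mu : nonadditive_measure X R.
Implicit Types (f g h : {mfun X >-> R}) (p c t : R).

Lemma measurable_gt_norm f t : measurable [set x | t < `|f x|].
Proof.
have mf : measurable_fun setT (fun x => `|f x|) by exact: measurableT_comp.
rewrite (_ : [set x | _] = setT `&` (fun x => `|f x|) @^-1` `]t, +oo[).
  exact: mf.
by apply/seteqP; split => x /=; rewrite in_itv/= andbT => // -[].
Qed.

Lemma measurable_gt_normB f g t : measurable [set x | t < `|f x - g x|].
Proof. exact: (measurable_gt_norm (f - g) t). Qed.

Lemma na_mu_null A B : measurable A -> measurable B -> A `<=` B ->
  mu B = 0%E -> mu A = 0%E.
Proof.
move=> mA mB AB B0; apply/eqP; rewrite eq_le na_mu_ge0// andbT -B0.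
exact: na_mu_le.
Qed.

Lemma monotone_autocontinuous_null_additive :
  monotone_autocontinuous_below mu -> null_additive mu.
Proof.
move=> hmu A B mA mB B0.
have mAB : measurable (A `|` B) by exact: measurableU.
have nB : nonincreasing_seq (fun=> B : set X) by move=> m n _; exact: lexx.
have := hmu (A `|` B) (fun=> B) mAB (fun=> mB) nB.
rewrite B0 => /(_ (cvg_cst _)) h.
have <- : mu ((A `|` B) `\` B) = mu (A `|` B).
  by apply: (cvg_unique (@ereal_hausdorff R)) h; exact: cvg_cst.
apply/eqP; rewrite eq_le; apply/andP; split.
  by apply: na_mu_le => //; [exact: measurableD|move=> x [[]]].
have := hmu A (fun=> B) mA (fun=> mB) nB.
rewrite B0 => /(_ (cvg_cst _)) hA.
have -> : mu A = mu (A `\` B).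
  by apply/esym; apply: (cvg_unique (@ereal_hausdorff R)) hA; exact: cvg_cst.
apply: na_mu_le; [exact: measurableD|exact: measurableD|].
by move=> x [Ax nBx]; split => //; left.
Qed.

Lemma mu_equivP f g : reflect
  (forall c : R, 0 < c -> mu [set x | c < `|f x - g x|] = 0%E)
  (mu_equiv mu f g).
Proof. exact: asboolP. Qed.

Lemma Shilkret_le_ub (nu : set X -> \bar R) (g : X -> R) M :
  (forall t, 0 <= t -> (t%:E * nu [set x | t < g x]%R <= M)%E) ->
  (Shilkret nu g <= M)%E.
Proof. by move=> h; apply: ub_ereal_sup => _ [t /= t0 <-]; exact: h. Qed.

Lemma weakLnorm_ub p f t : 0 <= t ->
  (t%:E * mu [set x | t < `|f x|]%R `^ p^-1 <= weakLnorm mu p f)%E.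
Proof. by move=> t0; apply: ereal_sup_ubound; exists t. Qed.

Lemma weakLnorm_ge0 p f : (0 <= weakLnorm mu p f)%E.
Proof. by have := weakLnorm_ub p f (lexx 0); rewrite mul0e. Qed.

Lemma weakLnorm0 p : 0 < p -> weakLnorm mu p (0 : {mfun X >-> R}) = 0%E.
Proof.
move=> p0; apply/eqP; rewrite eq_le weakLnorm_ge0 andbT.
apply: Shilkret_le_ub => t t0.
rewrite (_ : [set x | _] = set0) ?na_mu0 ?poweR0r ?mule0//.
  by rewrite gt_eqF// invr_gt0.
by apply/seteqP; split => x //=; rewrite normr0 ltNge t0.
Qed.

Lemma weakLnormZ p c f : 0 < p ->
  weakLnorm mu p (c *: f) = (`|c|%:E * weakLnorm mu p f)%E.
Proof.
move=> p0; have [->|c0] := eqVneq c 0.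
  by rewrite scale0r weakLnorm0// normr0 mul0e.
have leZ (a : R) g : a != 0 ->
    (weakLnorm mu p (a *: g) <= `|a|%:E * weakLnorm mu p g)%E.
  move=> a0; apply: Shilkret_le_ub => t t0.
  have na : 0 < `|a| by rewrite normr_gt0.
  rewrite (_ : [set x | _] = [set x | t / `|a| < `|g x|]); last first.
    by apply/seteqP; split => x /=; rewrite normrM ltr_pdivrMr// mulrC.
  rewrite -{1}(divfK (lt0r_neq0 na) t) mulrC EFinM -muleA.
  by apply: lee_wpmul2l; [rewrite lee_fin|apply: weakLnorm_ub; exact: divr_ge0].
apply/eqP; rewrite eq_le leZ//=.
rewrite -[in leLHS](scalerK c0 f).
apply: (@le_trans _ _ (`|c|%:E * (`|c^-1|%:E * weakLnorm mu p (c *: f)))%E).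
  by apply: lee_wpmul2l; [rewrite lee_fin|apply: leZ; rewrite invr_eq0].
by rewrite muleA -EFinM -normrM divff// normr1 mul1e.
Qed.

Hypothesis mu_sub : relaxed_subadditive mu.

Lemma relaxed_subadditive_cover : exists2 K : R, 1 <= K &
  forall A B C, measurable A -> measurable B -> measurable C ->
    C `<=` A `|` B -> (mu C <= K%:E * (mu A + mu B))%E.
Proof.
have [K K1 hK] := mu_sub; exists K => // A B C mA mB mC CAB.
have mBA : measurable (B `\` A) by exact: measurableD.
apply: (@le_trans _ _ (mu (A `|` (B `\` A)))).
  apply: na_mu_le => //; first exact: measurableU.
  move=> x Cx; have [Ax|Ax] := pselect (A x); first by left.
  by case: (CAB x Cx) => //; right.
apply: (le_trans (hK A (B `\` A) mA mBA _)); first by rewrite setDIK.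
apply: lee_wpmul2l; first by rewrite lee_fin (le_trans ler01).
by apply: leeD => //; apply: na_mu_le => // x [].
Qed.

Lemma relaxed_subadditive_null A B C :
  measurable A -> measurable B -> measurable C -> C `<=` A `|` B ->
  mu A = 0%E -> mu B = 0%E -> mu C = 0%E.
Proof.
move=> mA mB mC CAB A0 B0; have [K K1 /(_ A B C mA mB mC CAB)] :=
  relaxed_subadditive_cover.
rewrite A0 B0 adde0 mule0 => C0.
by apply/eqP; rewrite eq_le C0 na_mu_ge0.
Qed.

Lemma weakLnormD p : 0 < p -> exists2 K : R, 1 <= K & forall f g,
  (weakLnorm mu p (f + g)%R <= K%:E * (weakLnorm mu p f + weakLnorm mu p g))%E.
Proof.
move=> p0; have [K K1 hK] := relaxed_subadditive_cover.
have q0 : 0 <= p^-1 by rewrite invr_ge0 ltW.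
have K0 : 0 <= K by rewrite (le_trans ler01).
have K21 : 1 <= (K *+ 2) `^ p^-1.
  have {1}<- : 1 `^ p^-1 = 1 :> R by rewrite powR1.
  apply: ge0_ler_powR; rewrite ?nnegrE//; lra.
exists (2 * (K *+ 2) `^ p^-1); first by move: K21; lra.
move=> f g; apply: Shilkret_le_ub => t t0.
have t20 : 0 <= t / 2 by rewrite divr_ge0.
have step h :
    (mu [set x | (t < `|(f + g)%R x|)%R] <=
      (K *+ 2)%:E * mu [set x | (t / 2 < `|h x|)%R])%E ->
    (t%:E * mu [set x | (t < `|(f + g)%R x|)%R] `^ p^-1 <=
      (2 * (K *+ 2) `^ p^-1)%:E * weakLnorm mu p h)%E.
  set a := mu _; set b := mu _ => ab.
  have a0 : (0 <= a)%E by apply: na_mu_ge0; exact: measurable_gt_norm.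
  have b0 : (0 <= b)%E by apply: na_mu_ge0; exact: measurable_gt_norm.
  apply: (@le_trans _ _ (t%:E * ((K *+ 2)%:E * b) `^ p^-1)%E).
    apply: lee_wpmul2l; first by rewrite lee_fin.
    apply: gt0_ler_poweR => //; rewrite in_itv/= leey andbT//.
    by rewrite mule_ge0// lee_fin mulrn_wge0.
  rewrite poweRM ?lee_fin ?mulrn_wge0// poweR_EFin.
  rewrite (_ : t = 2 * (t / 2)); last by rewrite mulrC divfK.
  rewrite muleA -EFinM mulrAC EFinM -muleA.
  apply: lee_wpmul2l; first by rewrite lee_fin mulr_ge0// powR_ge0.
  exact: weakLnorm_ub.
have c0 : 0 <= 2 * (K *+ 2) `^ p^-1 by rewrite mulr_ge0// powR_ge0.
have {hK} := hK [set x | t / 2 < `|f x|] [set x | t / 2 < `|g x|]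
  [set x | t < `|(f + g) x|].
move=> /(_ (measurable_gt_norm _ _) (measurable_gt_norm _ _)).
move=> /(_ (measurable_gt_norm _ _)); move: step.
set a := mu [set x | _ < `|f x|]; set b := mu [set x | _ < `|g x|].
move=> step hK.
have {}hK : (mu [set x | (t < `|(f + g)%R x|)%R] <= K%:E * (a + b))%E.
  apply: hK => x /= tfg; have [?|tf] := ltP (t / 2) `|f x|; [by left|right].
  by rewrite ltNge; apply/negP => tg; have := ler_normD (f x) (g x); lra.
have hmax y : (a <= y)%E -> (b <= y)%E ->
    (mu [set x | (t < `|(f + g)%R x|)%R] <= (K *+ 2)%:E * y)%E.
  move=> ay yb; apply: (le_trans hK).
  have -> : ((K *+ 2)%:E * y = K%:E * (y + y))%E.
    by rewrite -mulr_natr EFinM -muleA muleC [in RHS]muleC mule_natl mule2n.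
  by apply: lee_wpmul2l; [rewrite lee_fin|exact: leeD].
have [ab|ba] := leP a b.
- apply: (le_trans (step g (hmax _ ab (lexx _)))).
  by apply: lee_wpmul2l; [rewrite lee_fin|rewrite leeDr// weakLnorm_ge0].
- apply: (le_trans (step f (hmax _ (lexx _) (ltW ba)))).
  by apply: lee_wpmul2l; [rewrite lee_fin|rewrite leeDl// weakLnorm_ge0].
Qed.

Lemma mu_equiv_refl : reflexive (mu_equiv mu).
Proof.
move=> f; apply/mu_equivP => c c0.
rewrite (_ : [set x | _] = set0) ?na_mu0//.
by apply/seteqP; split => x //=; rewrite subrr normr0 ltNge ltW.
Qed.

Lemma mu_equiv_sym : symmetric (mu_equiv mu).
Proof.
have sub f g : mu_equiv mu f g -> mu_equiv mu g f.
  move=> /mu_equivP fg; apply/mu_equivP => c /fg <-; congr (mu _).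
  by apply/seteqP; split => x /=; rewrite distrC.
by move=> f g; apply/idP/idP; exact: sub.
Qed.

Lemma mu_equivD f f' g g' :
  mu_equiv mu f f' -> mu_equiv mu g g' -> mu_equiv mu (f + g) (f' + g').
Proof.
move=> /mu_equivP ff /mu_equivP gg; apply/mu_equivP => c c0.
have c20 : 0 < c / 2 by rewrite divr_gt0.
apply: (relaxed_subadditive_null _ _ _ _ (ff _ c20) (gg _ c20));
  do ?exact: measurable_gt_normB.
move=> x /= cx; have [?|h] := ltP (c / 2) `|f x - f' x|; [by left|right].
rewrite ltNge; apply/negP => h'.
have := ler_normD (f x - f' x) (g x - g' x).
rewrite [X in `|X|](_ : _ = f x + g x - (f' x + g' x)); last by ring.
by move: cx; rewrite /=; lra.
Qed.

Lemma mu_equivZ a f f' :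
  mu_equiv mu f f' -> mu_equiv mu (a *: f) (a *: f').
Proof.
have [->|a0] := eqVneq a 0; first by rewrite !scale0r mu_equiv_refl.
move=> /mu_equivP ff; apply/mu_equivP => c c0.
have na : 0 < `|a| by rewrite normr_gt0.
rewrite -(ff (c / `|a|)) ?divr_gt0//; congr (mu _).
apply/seteqP; split => x /=; rewrite ltr_pdivrMr// -normrM mulrC mulrBr//.
Qed.

Lemma mu_equivN f f' : mu_equiv mu f f' -> mu_equiv mu (- f) (- f').
Proof. by move=> /(mu_equivZ (-1)); rewrite !scaleN1r. Qed.

Lemma mu_equiv_trans : transitive (mu_equiv mu).
Proof.
move=> g f h fg gh; have := mu_equivD fg gh.
move=> /mu_equivD /(_ (mu_equiv_refl (- g))).
by rewrite addrK [X in mu_equiv _ _ X](_ : _ = h)// addrAC subrr add0r.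
Qed.

Lemma weakLnorm_equiv p f g : 0 < p -> null_additive mu ->
  mu_equiv mu f g -> weakLnorm mu p f = weakLnorm mu p g.
Proof.
move=> p0 nadd.
have q0 : 0 <= p^-1 by rewrite invr_ge0 ltW.
suff le f' g' : mu_equiv mu f' g' ->
    (weakLnorm mu p f' <= weakLnorm mu p g')%E.
  by move=> fg; apply/eqP; rewrite eq_le !le// mu_equiv_sym.
move=> {f g} /mu_equivP fg; apply: Shilkret_le_ub => t; rewrite le_eqVlt.
move=> /predU1P[<-|t0]; first by rewrite mul0e weakLnorm_ge0.
set a := mu _.
have a0 : (0 <= a)%E by apply: na_mu_ge0; exact: measurable_gt_norm.
have hs s : 0 <= s -> s < t -> (s%:E * a `^ p^-1 <= weakLnorm mu p g')%E.
  move=> s0 st; apply: le_trans (weakLnorm_ub p g' s0).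
  apply: lee_wpmul2l; first by rewrite lee_fin.
  have ts : 0 < t - s by rewrite subr_gt0.
  apply: gt0_ler_poweR => //; rewrite ?in_itv/= ?leey ?andbT//.
    by apply: na_mu_ge0; exact: measurable_gt_norm.
  rewrite -(nadd _ [set x | t - s < `|f' x - g' x|]); first last.
  - exact: fg.
  - exact: measurable_gt_normB.
  - exact: measurable_gt_norm.
  apply: na_mu_le; first exact: measurable_gt_norm.
    apply: measurableU; first exact: measurable_gt_norm.
    exact: measurable_gt_normB.
  move=> x /= tf; have [?|h] := ltP s `|g' x|; [by left|right].
  by have := ler_normD (f' x - g' x) (g' x); rewrite subrK; lra.
have Q0 : (0 <= a `^ p^-1)%E by exact: poweR_ge0.
move: hs Q0; case: (a `^ p^-1)%E => [r| |] hs Q0 //.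
- have : forall s, 0 <= s -> s < t -> ((s * r)%:E <= weakLnorm mu p g')%E.
    by move=> s s0 st; rewrite EFinM; exact: hs.
  move: (weakLnorm_ge0 p g'); case: (weakLnorm mu p g') => [N| |] //= N0 h.
    rewrite -EFinM lee_fin; apply/ler_addgt0Pr => e e0.
    rewrite lee_fin in Q0.
    have d0 : 0 < r + 1 by lra.
    pose s := Num.max 0 (t - e / (r + 1)).
    have s0 : 0 <= s by rewrite le_max lexx.
    have st : s < t by rewrite gt_max t0/= ltrBlDr ltrDl divr_gt0.
    have := h s s0 st; rewrite lee_fin => srN.
    have : t - s <= e / (r + 1) by rewrite lerBlDr -lerBlDl le_max lexx orbT.
    rewrite ler_pdivlMr// => tse.
    have : 0 < t - s by lra.
    nra.
  by rewrite leey.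
- have := hs (t / 2); rewrite !gt0_muley ?lte_fin ?divr_gt0//.
  by apply; lra.
Qed.

End elementary.

(* The hypotheses [mu_sub] and [p0] are parameters of the types below because
   their linear structures depend on them. *)

Section weak_space.
Context d {X : measurableType d} {R : realType}.
Variables (mu : nonadditive_measure X R) (mu_sub : relaxed_subadditive mu).
Variables (p : R) (p0 : 0 < p).

Definition weakLfun of relaxed_subadditive mu & 0 < p :
    {pred {mfun X >-> R}} := fun f => (weakLnorm mu p f < +oo)%E.

Notation wL := (weakLfun mu_sub p0).

Lemma weakLfun_submod_closed : submod_closed wL.
Proof.
split=> [|a f g]; rewrite !unfold_in ?weakLnorm0// => fy gy.
have [K K1 hK] := weakLnormD mu_sub p0.
apply: (le_lt_trans (hK _ _)); rewrite lte_mul_pinfty ?lee_fin//.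
  by rewrite (le_trans ler01).
by rewrite lte_add_pinfty// weakLnormZ// lte_mul_pinfty ?lee_fin.
Qed.

HB.instance Definition _ :=
  GRing.isSubmodClosed.Build R _ wL weakLfun_submod_closed.

Record weakLfunType := WeakLfun {
  weakLfun_val :> {mfun X >-> R} ; _ : weakLfun_val \in wL }.

HB.instance Definition _ := [isSub for weakLfun_val].
HB.instance Definition _ := [Choice of weakLfunType by <:].
HB.instance Definition _ := [SubChoice_isSubLmodule of weakLfunType by <:].

Definition weakLfun_norm (f : weakLfunType) : R := fine (weakLnorm mu p f).

Definition mu_equiv_of of relaxed_subadditive mu := mu_equiv mu.

Canonical mu_equiv_equiv := EquivRel (mu_equiv_of mu_sub)
  (mu_equiv_refl mu) (mu_equiv_sym mu) (mu_equiv_trans mu_sub).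

Definition classes : Type := {eq_quot (mu_equiv_of mu_sub)}.
HB.instance Definition _ := Choice.on classes.
HB.instance Definition _ := EqQuotient.on classes.

Lemma classesE (f g : {mfun X >-> R}) :
  (f = g %[mod classes]) <->
  forall c : R, 0 < c -> mu [set x | c < `|f x - g x|] = 0%E.
Proof.
split=> [/eqP|h]; first by rewrite eqmodE => /mu_equivP.
by apply/eqP; rewrite eqmodE; apply/mu_equivP.
Qed.

Notation Q := classes.

Lemma mu_equiv_repr (f : {mfun X >-> R}) : mu_equiv mu f (repr (\pi_Q f)).
Proof.
by apply/mu_equivP; apply/(classesE f (repr (\pi_Q f))); rewrite reprK.
Qed.

Definition classes_zero : Q := lift_cst Q (0 : {mfun X >-> R}).
Definition classes_opp := lift_op1 Q (fun f : {mfun X >-> R} => - f).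
Definition classes_add := lift_op2 Q (fun f g : {mfun X >-> R} => f + g).
Definition classes_scale (c : R) :=
  lift_op1 Q (fun f : {mfun X >-> R} => c *: f).

Canonical pi_classes_zero := PiConst classes_zero.

Lemma pi_classes_opp : {morph \pi_Q : f / - f >-> classes_opp f}.
Proof.
move=> f; unlock classes_opp; apply/eqP; rewrite eqmodE.
exact: (mu_equivN (mu_equiv_repr f)).
Qed.
Canonical pi_classes_opp_morph := PiMorph1 pi_classes_opp.

Lemma pi_classes_add : {morph \pi_Q : f g / f + g >-> classes_add f g}.
Proof.
move=> f g; unlock classes_add; apply/eqP; rewrite eqmodE.
exact: (mu_equivD mu_sub (mu_equiv_repr f) (mu_equiv_repr g)).
Qed.
Canonical pi_classes_add_morph := PiMorph2 pi_classes_add.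

Lemma pi_classes_scale c : {morph \pi_Q : f / c *: f >-> classes_scale c f}.
Proof.
move=> f; unlock classes_scale; apply/eqP; rewrite eqmodE.
exact: (mu_equivZ c (mu_equiv_repr f)).
Qed.
Canonical pi_classes_scale_morph c := PiMorph1 (pi_classes_scale c).

Lemma classes_addA : associative classes_add.
Proof. by move=> f g h; rewrite -[f]reprK -[g]reprK -[h]reprK !piE addrA. Qed.
Lemma classes_addC : commutative classes_add.
Proof. by move=> f g; rewrite -[f]reprK -[g]reprK !piE addrC. Qed.
Lemma classes_add0 : left_id classes_zero classes_add.
Proof. by move=> f; rewrite -[f]reprK !piE add0r. Qed.
Lemma classes_addN : left_inverse classes_zero classes_opp classes_add.
Proof. by move=> f; rewrite -[f]reprK !piE addNr. Qed.

HB.instance Definition _ := GRing.isZmodule.Build Q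
  classes_addA classes_addC classes_add0 classes_addN.

Lemma classes_scaleA a b v :
  classes_scale a (classes_scale b v) = classes_scale (a * b) v.
Proof. by rewrite -[v]reprK !piE scalerA. Qed.
Lemma classes_scale1 : left_id 1 classes_scale.
Proof. by move=> v; rewrite -[v]reprK !piE scale1r. Qed.
Lemma classes_scaleDr : right_distributive classes_scale +%R.
Proof.
move=> a u v; rewrite -[u]reprK -[v]reprK -[+%R]/classes_add.
by rewrite !piE scalerDr.
Qed.
Lemma classes_scaleDl v : {morph classes_scale^~ v : a b / a + b}.
Proof.
move=> a b; rewrite -[v]reprK -[X in _ = X]/(classes_add _ _).
by rewrite !piE scalerDl.
Qed.

HB.instance Definition _ := GRing.Zmodule_isLmodule.Build R Q
  classes_scaleA classes_scale1 classes_scaleDr classes_scaleDl.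

Lemma classes_piD (f g : {mfun X >-> R}) : \pi_Q (f + g) = \pi_Q f + \pi_Q g.
Proof. by rewrite -[RHS]/(classes_add _ _) !piE. Qed.
Lemma classes_piZ (c : R) (f : {mfun X >-> R}) :
  \pi_Q (c *: f) = c *: \pi_Q f.
Proof. by rewrite -[RHS]/(classes_scale _ _) !piE. Qed.
Lemma classes_pi0 : \pi_Q (0 : {mfun X >-> R}) = 0.
Proof. by rewrite -[RHS]/classes_zero !piE. Qed.

Definition weakLclass : {pred Q} :=
  fun q => `[< exists2 f : {mfun X >-> R}, f \in wL & q = \pi_Q f >].

Notation wLc := weakLclass.

Lemma weakLclass_submod_closed : submod_closed wLc.
Proof.
split=> [|a u v].
  apply/asboolP; exists 0; last by rewrite classes_pi0.
  by have [] := weakLfun_submod_closed.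
move=> /asboolP[f fL ->] /asboolP[g gL ->]; apply/asboolP.
exists (a *: f + g); last by rewrite classes_piD classes_piZ.
by have [_] := weakLfun_submod_closed; exact.
Qed.

HB.instance Definition _ :=
  GRing.isSubmodClosed.Build R _ wLc weakLclass_submod_closed.

Record weakLType := WeakL { weakL_val :> Q ; _ : weakL_val \in wLc }.

HB.instance Definition _ := [isSub for weakL_val].
HB.instance Definition _ := [Choice of weakLType by <:].
HB.instance Definition _ := [SubChoice_isSubLmodule of weakLType by <:].

Definition weakL_norm (q : weakLType) : R :=
  fine (weakLnorm mu p (repr (weakL_val q))).

(* [weakL_norm] does not depend on the representative chosen by [repr]. *)
Lemma weakL_normE (q : weakLType) (f : {mfun X >-> R}) : null_additive mu ->
  weakL_val q = \pi_Q f -> weakL_norm q = fine (weakLnorm mu p f).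
Proof.
move=> nadd qf; congr fine; apply: weakLnorm_equiv => //.
by rewrite qf mu_equiv_sym; exact: mu_equiv_repr.
Qed.

End weak_space.

Arguments weakLfun_norm {d X R mu} mu_sub {p} p0 f.
Arguments weakL_norm {d X R mu} mu_sub {p} p0 q.

(* Main.v *)
(** A Cauchy sequence for the weak norm is Cauchy in measure. A subsequence
    [f (phi j)] has increments larger than [2^-j] only on sets [E_j] whose
    measures decrease so fast that relaxed subadditivity bounds all finite
    unions; property (C) then gives [mu (B_k) --> 0] for the tails
    [B_k = \bigcup_(j >= k) E_j], and the subsequence converges uniformly to
    some [g] off each [B_k]. Off [B_k], [t < |f_m - g|] forces
    [t / 2 < |f_m - f (phi j)|] for large [j], and autocontinuity removes the
    exceptional set [B_k] from this estimate; the loss of a factor 2 is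
    harmless. *)

Require Import Defs.
From mathcomp Require Import all_boot all_order all_algebra.
From mathcomp Require Import all_classical all_reals all_analysis.
From mathcomp Require Import generic_quotient measurable_realfun zify ring lra.

Import Order.TTheory GRing.Theory Num.Theory.
Import numFieldNormedType.Exports.

Local Open Scope classical_set_scope.
Local Open Scope ring_scope.
Local Open Scope quotient_scope.

(** Telescoping against the geometric series bounds [|a i - a j|] by [2 * 2 ^- j] for [k <= j <= i].
    This gives the Cauchy property, and letting [i] tend to infinity bounds the distance to the
    limit. *)
Lemma dyadic_increments_cvg (R : realType) (a : nat -> R) (k : nat) :
  (forall j, (k <= j)%N -> `|a j.+1 - a j| <= 2 ^- j) ->
  cvgn a /\ forall j, (k <= j)%N -> `|a j - limn a| <= 2 * 2 ^- j.
Proof.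
move=> ha.
(* The subtracted term makes the bound the exact partial geometric sum, which lets the induction on
   [i] close. *)
have step j i : (k <= j)%N ->
    `|a (j + i)%N - a j| <= 2 * 2 ^- j - 2 * 2 ^- (j + i).
  move=> kj; elim: i => [|i IH]; first by rewrite addn0 !subrr normr0.
  have := ha (j + i)%N (leq_trans kj (leq_addr _ _)).
  have -> : a (j + i.+1)%N - a j =
      (a (j + i).+1 - a (j + i)%N) + (a (j + i)%N - a j).
    by rewrite addnS; ring.
  have := ler_normD (a (j + i).+1 - a (j + i)%N) (a (j + i)%N - a j).
  have -> : (2 : R) ^- (j + i.+1) = 2 ^- (j + i) / 2
    by rewrite addnS exprSr invfM.
  by move: IH; lra.
have dist j i : (k <= j)%N -> (j <= i)%N -> `|a i - a j| <= 2 * 2 ^- j.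
  move=> kj /subnKC <-; apply: (le_trans (step j _ kj)).
  by rewrite gerBl mulr_ge0// invr_ge0 exprn_ge0.
have cva : cvgn a.
  apply: cauchy_cvg; apply: cauchy_exP => e e0.
  have : geometric 2 2^-1 n @[n --> \oo] --> (0 : R).
    by apply: cvg_geometric; rewrite ger0_norm ?invr_ge0// invf_lt1// ltr1n.
  move=> /cvgrPdist_lt /(_ _ e0) [N _ hN].
  have jN : (N <= maxn k N)%N by exact: leq_maxr.
  exists (a (maxn k N)); exists (maxn k N) => // i /= ji.
  rewrite /ball/= distrC; apply: (le_lt_trans (dist _ _ (leq_maxl _ _) ji)).
  apply: le_lt_trans (hN _ jN).
  by rewrite sub0r normrN /geometric/= exprVn ler_norm.
split=> // j kj; rewrite distrC.
apply: (@cvgr_to_le _ \oo _ R (fun i => `|a i - a j|)).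
  by apply: cvg_norm; apply: cvgB => //; exact: cvg_cst.
by exists j => // i /= ji; exact: dist.
Qed.

(** * Borel-Cantelli and convergence off small sets for nonadditive measures *)

Section nonadditive_convergence.
Local Set Implicit Arguments.
Local Unset Strict Implicit.
Context {d : measure_display} {X : measurableType d} {R : realType}.
Variable mu : nonadditive_measure X R.

(* With [delta n = (2K)^-(n+1)], iterated relaxed subadditivity bounds the
   measure of [E_k `|` ... `|` E_(k+l)] by [(2K)^-k] uniformly in [l]. *)
Lemma property_C_Borel_Cantelli :
  relaxed_subadditive mu -> property_C mu ->
  exists2 delta : nat -> R, forall n, 0 < delta n &
    forall E : nat -> set X, (forall n, measurable (E n)) ->
      (forall n, mu (E n) <= (delta n)%:E)%E ->
      mu (\bigcup_(n in [set n | (k <= n)%N]) E n) @[k --> \oo] --> 0%E.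
Proof.
move=> /relaxed_subadditive_cover [K K1 hK] hC.
have K0 : 0 < K by rewrite (lt_le_trans ltr01).
have K20 : 0 < 2 * K by rewrite mulr_gt0.
exists (fun n => (2 * K) ^- n.+1) => [n|E mE hE].
  by rewrite invr_gt0 exprn_gt0.
have mF k l : measurable (\bigcup_(n in [set n | (k <= n <= k + l)%N]) E n).
  by apply: bigcup_measurable => n _; exact: mE.
have bound l k : (mu (\bigcup_(n in [set n | (k <= n <= k + l)%N]) E n) <=
    ((2 * K) ^- k)%:E)%E.
  have dS m : (2 * K) ^- m.+1 = (2 * K) ^- m / (2 * K).
    by rewrite exprSr invfM.
  (* [k] stays general: the union splits into [E k] and a union starting at [k.+1], each of measure
     at most [(2 * K) ^- k.+1], so the factor [K] yields [(2 * K) ^- k]. *)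
  elim: l k => [|l IH] k.
    apply: (@le_trans _ _ (mu (E k))).
      apply: na_mu_le => // x [n /=]; rewrite addn0 => /andP[kn nk].
      by have -> : n = k by apply/eqP; rewrite eqn_leq kn nk.
    apply: (le_trans (hE k)); rewrite lee_fin dS ler_pdivrMr//.
    rewrite ler_peMr ?invr_ge0 ?exprn_ge0 ?(ltW K20)//.
    by move: K1; lra.
  apply: (@le_trans _ _ (K%:E * (mu (E k) +
      mu (\bigcup_(n in [set n | (k.+1 <= n <= k.+1 + l)%N]) E n)))%E).
    apply: hK => // x [n /= /andP[kn nk] Enx].
    move: kn; rewrite leq_eqVlt => /predU1P[->|kn]; [by left|right].
    by exists n => //=; rewrite kn addSnnS.
  apply: (@le_trans _ _
    (K%:E * (((2 * K) ^- k.+1)%:E + ((2 * K) ^- k.+1)%:E))%E).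
    apply: lee_wpmul2l; first by rewrite lee_fin ltW.
    by apply: leeD; [exact: hE|exact: IH].
  rewrite -EFinD -EFinM lee_fin dS le_eqVlt; apply/orP; left; apply/eqP.
  by field; rewrite expf_neq0 ?gt_eqF.
apply: hC => //.
apply: (@squeeze_cvge _ \oo _ _ (fun=> 0%E) _ (fun k => ((2 * K) ^- k)%:E)).
- exists 0%N => // k _ /=; apply/andP; split.
    apply: (@le_trans _ _
      (mu (\bigcup_(n in [set n | (k <= n <= k + 0)%N]) E n))).
      exact: na_mu_ge0.
    by apply: ereal_sup_ubound; exists 0%N.
  by apply: ge_ereal_sup => _ [l _ <-]; exact: bound.
- exact: cvg_cst.
- apply: cvg_EFin; first by exists 0%N.
  rewrite (_ : _ \o _ = geometric 1 (2 * K)^-1); last first.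
    by apply/funext => n; rewrite /geometric/= mul1r exprVn.
  apply: cvg_geometric; rewrite ger0_norm ?invr_ge0 ?ltW// invf_lt1//.
  by move: K1; lra.
Qed.

(** The sets [B k] are part of the conclusion because autocontinuity acts on such a nonincreasing
    sequence; off them the rate is uniform in [x]. *)
Lemma cauchy_in_measure_subsequence (f : nat -> {mfun X >-> R}) :
  relaxed_subadditive mu -> property_C mu ->
  (forall c delta : R, 0 < c -> 0 < delta -> exists n0 : nat, forall m n,
    (n0 <= m)%N -> (n0 <= n)%N ->
    (mu [set x | c < `|f m x - f n x|]%R <= delta%:E)%E) ->
  exists (phi : nat -> nat) (g : {mfun X >-> R}) (B : nat -> set X),
  [/\ forall k, (k <= phi k)%N,
      forall k, measurable (B k),
      nonincreasing_seq B,
      mu (B k) @[k --> \oo] --> 0%E &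
      forall k j x, (k <= j)%N -> ~ B k x ->
        `|f (phi j) x - g x| <= 2 * 2 ^- j].
Proof.
move=> hsub hC hf.
have [delta delta0 hdelta] := property_C_Borel_Cantelli hsub hC.
have pow0 k : 0 < (2 : R) ^- k by rewrite invr_gt0 exprn_gt0.
have [n0 hn0] := choice (fun k => hf _ _ (pow0 k) (delta0 k)).
(* The summand [k] gives [k <= phi k]; the sum makes both [phi k] and [phi k.+1] at least [n0 k], so
   that [E k] below has measure at most [delta k]. *)
pose phi k := (k + \sum_(i < k.+1) n0 i)%N.
have phi_ge k : (k <= phi k)%N by exact: leq_addr.
have phi_n0 k : (n0 k <= phi k)%N.
  by rewrite /phi big_ord_recr/= addnA leq_addl.
have phi_n0S k : (n0 k <= phi k.+1)%N.
  by rewrite /phi big_ord_recr/= big_ord_recr/=; lia.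
pose E k := [set x | 2 ^- k < `|f (phi k.+1) x - f (phi k) x|].
have mE k : measurable (E k) by exact: measurable_gt_normB.
pose B k := \bigcup_(n in [set n | (k <= n)%N]) E n.
have mB k : measurable (B k) by exact: bigcup_measurable.
have incr k j x : (k <= j)%N -> ~ B k x ->
    `|f (phi j.+1) x - f (phi j) x| <= 2 ^- j.
  by move=> kj nB; rewrite leNgt; apply/negP => h; apply: nB; exists j.
(* A point off [D] avoids some [B k], so [f (phi j) x] converges there. The indicator in [h]
   replaces the sequence by 0 on [D], so the limit exists everywhere and is measurable. *)
pose D := \bigcap_(k in setT) B k.
have mD : measurable (~` D).
  by apply: measurableC; apply: bigcap_measurable => //; exists 0%N.
pose h j x : R := f (phi j) x * \1_(~` D) x.
have hE j k x : ~ B k x -> h j x = f (phi j) x.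
  move=> nB; rewrite /h indicE mem_set ?mulr1//.
  by move=> /(_ k I).
have mh j : measurable_fun setT (h j).
  by apply: measurable_funM => //; exact: measurable_indic.
have mg : measurable_fun setT (fun x => limn (h ^~ x)).
  apply: (measurable_fun_cvg mh) => x _.
  have [Dx|] := pselect (D x).
    rewrite (_ : h ^~ x = fun=> 0); first exact: is_cvg_cst.
    by apply/funext => j; rewrite /h indicE memNset ?mulr0//; apply.
  move=> /existsNP[k /existsNP[_ nB]].
  apply: (proj1 (@dyadic_increments_cvg _ _ k _)) => j kj.
  by rewrite !(hE _ _ _ nB); exact: (incr _ _ _ _ nB).
exists phi, (mfun_Sub (mem_set mg)), B; split => //.
- move=> m n mn; apply/subsetPset => x [j /= nj Ej].
  by exists j => //=; exact: leq_trans nj.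
- by apply: hdelta => // k; exact: hn0.
- move=> k j x kj nB; rewrite /= -(hE j _ _ nB).
  apply: (proj2 (@dyadic_increments_cvg _ (h ^~ x) k _)) => // i ki.
  by rewrite !(hE _ _ _ nB); exact: (incr _ _ _ _ nB).
Qed.

(** * Weak norm bounds as tail estimates, and the limit function *)

Lemma poweR_inv_le (p r : R) (a : \bar R) : 0 < p -> 0 <= r -> (0 <= a)%E ->
  (a `^ p^-1 <= r%:E)%E = (a <= (r `^ p)%:E)%E.
Proof.
move=> p0 r0 a0; have pn0 : p != 0 by rewrite gt_eqF.
have pV0 : 0 <= p^-1 by rewrite invr_ge0 ltW.
apply/idP/idP => h.
- rewrite -[a]poweRe1// -(mulVf pn0) poweRrM -poweR_EFin.
  apply: gt0_ler_poweR; rewrite ?in_itv/= ?leey ?andbT ?poweR_ge0 ?lee_fin//.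
  exact: ltW.
- rewrite -[r]powRr1// -[X in r `^ X](mulfV pn0) powRrM -poweR_EFin.
  apply: gt0_ler_poweR; rewrite ?in_itv/= ?leey ?andbT ?lee_fin//.
  exact: powR_ge0.
Qed.

Lemma weakLnorm_leP (p e : R) (f : {mfun X >-> R}) : 0 < p -> 0 <= e ->
  (weakLnorm mu p f <= e%:E)%E <->
  forall t, 0 < t -> (mu [set x | t < `|f x|]%R <= ((e / t) `^ p)%:E)%E.
Proof.
move=> p0 e0; split=> [h t t0|h].
  rewrite -poweR_inv_le ?divr_ge0 ?(ltW t0)//; last first.
    by apply: na_mu_ge0; exact: measurable_gt_norm.
  rewrite mulrC EFinM lee_pdivlMl//; apply: le_trans h.
  exact: weakLnorm_ub (ltW t0).
(* The level [t = 0] contributes 0 even when the measure is infinite, by the convention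
   [0 * +oo = 0]. *)
apply: Shilkret_le_ub => t; rewrite le_eqVlt => /predU1P[<-|t0].
  by rewrite mul0e lee_fin.
rewrite -lee_pdivlMl// -EFinM mulrC poweR_inv_le ?divr_ge0 ?(ltW t0)//.
  exact: h.
by apply: na_mu_ge0; exact: measurable_gt_norm.
Qed.

Lemma weakLnorm_cauchy_in_measure (p : R) (f : nat -> {mfun X >-> R}) :
  0 < p ->
  (forall e : R, 0 < e -> exists n0 : nat, forall m n, (n0 <= m)%N ->
    (n0 <= n)%N -> (weakLnorm mu p (f m - f n)%R <= e%:E)%E) ->
  forall c delta : R, 0 < c -> 0 < delta -> exists n0 : nat, forall m n,
    (n0 <= m)%N -> (n0 <= n)%N ->
    (mu [set x | c < `|f m x - f n x|]%R <= delta%:E)%E.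
Proof.
move=> p0 hf c delta c0 delta0.
have e0 : 0 < c * delta `^ p^-1 by rewrite mulr_gt0// powR_gt0.
have [n0 hn0] := hf _ e0; exists n0 => m n mn0 nn0.
have /weakLnorm_leP := hn0 m n mn0 nn0.
move=> /(_ p0 (ltW e0) c c0).
rewrite mulrAC divff ?gt_eqF// mul1r -powRrM mulVf ?gt_eqF//.
by rewrite powRr1// ltW.
Qed.

(** Only extended norms of differences occur, so the result applies both to functions and to
    representatives of classes. *)
Lemma weakLnorm_complete (p : R) (f : nat -> {mfun X >-> R}) : 0 < p ->
  relaxed_subadditive mu -> monotone_autocontinuous_below mu ->
  property_C mu ->
  (forall e : R, 0 < e -> exists n0 : nat, forall m n, (n0 <= m)%N ->
    (n0 <= n)%N -> (weakLnorm mu p (f m - f n)%R <= e%:E)%E) ->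
  exists g : {mfun X >-> R}, forall e : R, 0 < e -> exists n0 : nat,
    forall n, (n0 <= n)%N -> (weakLnorm mu p (f n - g)%R <= e%:E)%E.
Proof.
move=> p0 hsub hauto hC hf.
have [phi [g [B [phi_ge mB nB B0 fgB]]]] :=
  cauchy_in_measure_subsequence hsub hC (weakLnorm_cauchy_in_measure p0 hf).
(* Halving [e] pays for halving the level: [(e / 2) / (t / 2) = e / t]. *)
exists g => e e0; have e20 : 0 < e / 2 by rewrite divr_gt0.
have [n0 hn0] := hf _ e20; exists n0 => m mn0.
apply/weakLnorm_leP => //; first exact: ltW.
move=> t t0; have t20 : 0 < t / 2 by rewrite divr_gt0.
have mA : measurable [set x | t < `|(f m - g)%R x|]
  by exact: measurable_gt_norm.
(* The measures of [A] minus [B j] tend to that of [A], where [A] is the level set of [f m - g]; a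
   bound holding for all large [j] therefore passes to [A]. *)
apply: cvge_to_le (hauto _ _ mA mB nB B0) _.
have : geometric 2 2^-1 n @[n --> \oo] --> (0 : R).
  by apply: cvg_geometric; rewrite ger0_norm ?invr_ge0// invf_lt1// ltr1n.
move=> /cvgrPdist_lt /(_ _ t20) [N _ hN].
exists (maxn N n0) => // j /=; rewrite geq_max => /andP[Nj n0j].
have := hn0 m (phi j) mn0 (leq_trans n0j (phi_ge j)).
move=> /(weakLnorm_leP _ p0 (ltW e20)) /(_ _ t20).
rewrite (_ : e / 2 / (t / 2) = e / t); last by field; rewrite gt_eqF.
apply: le_trans; apply: na_mu_le; first exact: measurableD.
  exact: measurable_gt_norm.
move=> x [/= tA nBx].
(* The exceptional set and the subsequence index advance together: off [B j] the error is at most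
   [2 * 2 ^- j], below [t / 2]. *)
have := fgB j j x (leqnn j) nBx.
have := hN j Nj; rewrite sub0r normrN /geometric/= exprVn.
move=> /(le_lt_trans (ler_norm _)).
have := ler_normD (f m x - f (phi j) x) (f (phi j) x - g x).
rewrite [X in `|X| <= _](_ : _ = f m x - g x); last by ring.
by move: tA => /=; lra.
Qed.

End nonadditive_convergence.

(** * Transfer to the function space and to its quotient *)

Lemma converges_in_le (R : realType) (V : lmodType R) (N : V -> R)
    (u : nat -> V) (x : V) :
  (forall y, 0 <= N y) ->
  (forall e : R, 0 < e -> exists n0 : nat,
    forall n, (n0 <= n)%N -> N (u n - x) <= e) ->
  converges_in N u x.
Proof.
move=> N0 h; apply/cvgrPdist_le => e /h [n0 hn0].
by exists n0 => // n /= /hn0; rewrite sub0r normrN ger0_norm.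
Qed.

Section weak_space_norms.
Context {d : measure_display} {X : measurableType d} {R : realType}.
Variables (mu : nonadditive_measure X R) (p : R) (p0 : 0 < p).
Hypothesis mu_sub : relaxed_subadditive mu.
Local Set Implicit Arguments.
Local Unset Strict Implicit.

Notation Lfun := (weakLfunType mu_sub p0).
Notation Lq := (weakLType mu_sub p0).
Notation Q := (classes mu_sub).

Lemma weakLfun_valZ c (f : Lfun) : weakLfun_val (c *: f) = c *: weakLfun_val f.
Proof. exact: GRing.valZ. Qed.

Lemma weakLfun_valD (f g : Lfun) :
  weakLfun_val (f + g) = weakLfun_val f + weakLfun_val g.
Proof. exact: (raddfD (\val : Lfun -> {mfun X >-> R})). Qed.

Lemma weakLfun_valB (f g : Lfun) :
  weakLfun_val (f - g) = weakLfun_val f - weakLfun_val g.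
Proof. exact: (raddfB (\val : Lfun -> {mfun X >-> R})). Qed.

Lemma classes_piB (f g : {mfun X >-> R}) : \pi_Q (f - g) = \pi_Q f - \pi_Q g.
Proof. by rewrite -[in LHS]scaleN1r classes_piD classes_piZ scaleN1r. Qed.

Lemma weakL_valZ c (q : Lq) : weakL_val (c *: q) = c *: weakL_val q.
Proof. exact: GRing.valZ. Qed.

Lemma weakL_valD (q r : Lq) : weakL_val (q + r) = weakL_val q + weakL_val r.
Proof. exact: (raddfD (\val : Lq -> Q)). Qed.

Lemma weakL_valB (q r : Lq) : weakL_val (q - r) = weakL_val q - weakL_val r.
Proof. exact: (raddfB (\val : Lq -> Q)). Qed.

Lemma weakLfun_normE (f : Lfun) :
  (weakLfun_norm mu_sub p0 f)%:E = weakLnorm mu p (weakLfun_val f).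
Proof.
by apply: fineK; rewrite ge0_fin_numE ?weakLnorm_ge0//; exact: valP f.
Qed.

Lemma weakLfun_quasi_seminorm : quasi_seminorm (weakLfun_norm mu_sub p0).
Proof.
split=> [f|c f|]; first by rewrite -lee_fin weakLfun_normE weakLnorm_ge0.
  by apply: EFin_inj; rewrite EFinM !weakLfun_normE weakLfun_valZ weakLnormZ.
have [K K1 hK] := weakLnormD mu_sub p0; exists K => // f g.
by rewrite -lee_fin EFinM EFinD !weakLfun_normE weakLfun_valD.
Qed.

Lemma weakLfun_complete : monotone_autocontinuous_below mu -> property_C mu ->
  complete_in (weakLfun_norm mu_sub p0).
Proof.
move=> hauto hC u hu.
have /(weakLnorm_complete p0 mu_sub hauto hC) : forall e : R, 0 < e ->
    exists n0 : nat, forall m n, (n0 <= m)%N -> (n0 <= n)%N ->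
    (weakLnorm mu p (weakLfun_val (u m) - weakLfun_val (u n))%R <= e%:E)%E.
  move=> e /hu [n0 hn0]; exists n0 => m n m0 n1.
  by rewrite -weakLfun_valB -weakLfun_normE lee_fin ltW// hn0.
move=> [g hg].
(* One term at finite distance from [g] suffices: [g] is [u n1] minus a function of finite norm. *)
have [n1 hn1] := hg 1 ltr01.
have gL : g \in weakLfun mu_sub p0.
  rewrite -(subKr (weakLfun_val (u n1)) g) rpredB//; first exact: valP (u n1).
  by apply: le_lt_trans (hn1 n1 (leqnn n1)) _; rewrite ltry.
exists (WeakLfun gL); apply: converges_in_le.
  by have [] := weakLfun_quasi_seminorm.
move=> e /hg [n0 hn0]; exists n0 => n /hn0.
by rewrite -lee_fin weakLfun_normE weakLfun_valB.
Qed.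

Hypothesis mu_null : null_additive mu.

(** Some representative has finite norm by membership, and null-additivity gives [f] the same norm,
    so [fine] loses nothing. *)
Lemma weakL_norm_pi (q : Lq) (f : {mfun X >-> R}) :
  weakL_val q = \pi_Q f ->
  (weakL_norm mu_sub p0 q)%:E = weakLnorm mu p f.
Proof.
move=> qf; rewrite (weakL_normE mu_null qf); apply: fineK.
rewrite ge0_fin_numE ?weakLnorm_ge0//.
have /asboolP[g gL qg] := valP q.
rewrite (weakLnorm_equiv p0 mu_null (_ : mu_equiv mu f g))//.
by apply/mu_equivP; apply/(classesE mu_sub f g); rewrite -qf.
Qed.

(** [repr] need not be additive, so the difference of chosen representatives serves as another
    representative of [q - r]. *)
Lemma weakL_piB (q r : Lq) :
  weakL_val (q - r) = \pi_Q (repr (weakL_val q) - repr (weakL_val r)).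
Proof. by rewrite weakL_valB classes_piB !reprK. Qed.

Lemma weakL_quasi_norm : quasi_norm (weakL_norm mu_sub p0).
Proof.
have reprE (q : Lq) := weakL_norm_pi (esym (reprK (weakL_val q))).
split; first split=> [q|c q|].
- by rewrite -lee_fin reprE weakLnorm_ge0.
- apply: EFin_inj; rewrite EFinM (reprE q) -weakLnormZ//; apply: weakL_norm_pi.
  by rewrite weakL_valZ classes_piZ reprK.
- have [K K1 hK] := weakLnormD mu_sub p0; exists K => // q r.
  rewrite -lee_fin EFinM EFinD (reprE q) (reprE r).
  rewrite (@weakL_norm_pi _ (repr (weakL_val q) + repr (weakL_val r)))//.
  by rewrite weakL_valD classes_piD !reprK.
(* With [e = 0] the tail estimate makes every level set at [c > 0] null, which is equivalence to
   0. *)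
- move=> q q0; apply: val_inj => /=; rewrite -[LHS]reprK -[RHS]classes_pi0.
  apply/classesE => c c0.
  have := reprE q; rewrite q0 => /esym/eqP; rewrite eq_le => /andP[h _].
  have := proj1 (weakLnorm_leP mu (repr (weakL_val q)) p0 (lexx 0)) h c c0.
  rewrite mul0r powR0 ?gt_eqF// => le0.
  rewrite (_ : [set x | _] = [set x | c < `|repr (weakL_val q) x|]); last first.
    by apply/seteqP; split => x /=; rewrite subr0.
  by apply/eqP; rewrite eq_le le0 na_mu_ge0//; exact: measurable_gt_norm.
Qed.

Lemma weakL_complete : monotone_autocontinuous_below mu -> property_C mu ->
  complete_in (weakL_norm mu_sub p0).
Proof.
move=> hauto hC u hu.
pose f n : {mfun X >-> R} := repr (weakL_val (u n)).
have /(weakLnorm_complete p0 mu_sub hauto hC) : forall e : R, 0 < e ->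
    exists n0 : nat, forall m n, (n0 <= m)%N -> (n0 <= n)%N ->
    (weakLnorm mu p (f m - f n)%R <= e%:E)%E.
  move=> e /hu [n0 hn0]; exists n0 => m n m0 n1.
  by rewrite -(weakL_norm_pi (weakL_piB (u m) (u n))) lee_fin ltW// hn0.
move=> [g hg].
have [n1 hn1] := hg 1 ltr01.
have fE n : weakL_val (u n) = \pi_Q (f n) by rewrite reprK.
have gL : \pi_Q g \in weakLclass (mu_sub := mu_sub) p0.
  rewrite -(subKr (weakL_val (u n1)) (\pi_Q g)) rpredB//.
    exact: valP (u n1).
  apply/asboolP; exists (f n1 - g).
    by apply: le_lt_trans (hn1 n1 (leqnn n1)) _; rewrite ltry.
  by rewrite fE -classes_piB.
exists (WeakL gL); apply: converges_in_le.
  by have [[]] := weakL_quasi_norm.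
move=> e /hg [n0 hn0]; exists n0 => n /hn0.
rewrite -lee_fin (@weakL_norm_pi _ (f n - g))//.
by rewrite weakL_valB /= fE -classes_piB.
Qed.

End weak_space_norms.

Theorem corollary7p5 (d : measure_display) (X : measurableType d)
    (R : realType) (mu : nonadditive_measure X R) (p : R) (p0 : 0 < p)
    (mu_sub : relaxed_subadditive mu)
    (mu_auto : monotone_autocontinuous_below mu)
    (mu_C : property_C mu) :
  (quasi_seminorm (weakLfun_norm mu_sub p0) /\
   complete_in (weakLfun_norm mu_sub p0)) /\
  (quasi_norm (weakL_norm mu_sub p0) /\
   complete_in (weakL_norm mu_sub p0)).
Proof.
(* Null-additivity makes the quotient norm independent of representatives. *)
have mu_null := monotone_autocontinuous_null_additive mu_auto.
split; split.
- exact: weakLfun_quasi_seminorm.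
- exact: weakLfun_complete.
- exact: weakL_quasi_norm.
- exact: weakL_complete.
Qed.
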